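(* Let $n\ge 1$ be an integer, let $p>1$, $q>0$, $\alpha>0$ be real constants, let $\varphi(v)=v|v|^{p-2}$, and set $\beta=\frac{\alpha+p}{p+q-1}$. Assume that $$(p-1)(\beta-1)+n-1>\beta,\qquad 4q-(p-2)^2>0,$$ and $$\frac{\alpha+p}{p+q-1}>\frac{(p-n)\left(2q-p^2+3p-2\right)+2|n-p|\sqrt{q(p+q-1)}}{(p-1)\left[4q-(p-2)^2\right]}.$$ Then the solution curve of the problem $$\varphi(u')'+\frac{n-1}{r}\varphi(u')+\lambda\,\frac{r^{\alpha}}{(1-u)^q}=0\ \ (0<r<1),\qquad u'(0)=u(1)=0,\quad 0<u(r)<1\ \ (0\le r<1)$$ makes infinitely many turns. Moreover, along this curve, as $u(0)\to 1$ (that is, as the curve parameter $t\to\infty$), $\lambda$ tends to $$\lambda_0=\frac{1}{c_0^{\,p+q-1}}=\beta^{p-1}\left[(p-1)(\beta-1)+n-1\right],$$ and $u(r)$ tends to $1-r^{\beta}$ for each $r\in(0,1]$; the function $u(r)=1-r^\beta$ is a solution, for $0<r<1$, of the differential equation $\varphi(u')'+\frac{n-1}{r}\varphi(u')+\lambda_0\,\frac{r^{\alpha}}{(1-u)^q}=0$.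
   Context: Here $\lambda>0$ is a parameter. Let $w(t)$ be the solution of the initial value problem $\varphi(w')'+\frac{n-1}{t}\varphi(w')=\frac{t^{\alpha}}{w^q}$ for $t>0$, $w(0)=1$, $w'(0)=0$; it is positive, increasing and defined for all $t>0$. The solution pairs $(\lambda,u)$ of the boundary value problem are exactly those given, for $t\in(0,\infty)$, by $\lambda=\lambda(t)=\frac{t^{\alpha+p}}{w(t)^{p+q-1}}$ and $u(r)=1-\frac{w(tr)}{w(t)}$, so that $u(0)=1-\frac{1}{w(t)}$. The solution curve is the curve $t\mapsto(\lambda(t),u(0))=\left(\frac{t^{\alpha+p}}{w(t)^{p+q-1}},\,1-\frac1{w(t)}\right)$, $t\in(0,\infty)$. ''The solution curve makes infinitely many turns'' means that $\lambda(t)$ changes its direction of monotonicity (i.e. $\lambda'(t)$ changes sign) infinitely many times on $(0,\infty)$. The constant $c_0$ is $c_0=\left[\frac{1}{\beta^{p-1}\left[(p-1)(\beta-1)+n-1\right]}\right]^{\frac{1}{p+q-1}}$. *)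

(* Defs.v *)
From Stdlib Require Import Reals List.
From Coquelicot Require Import Coquelicot.

Open Scope R_scope.

(* At [v = 0] the junk value [Rpower 0 _ = 1] is multiplied by [0], so
   [phi p 0 = 0]. *)
Definition phi (p v : R) : R := v * Rpower (Rabs v) (p - 2).

Definition radial_plaplacian (n : nat) (p : R) (u : R -> R) (r : R) : R :=
  Derive (fun s => phi p (Derive u s)) r
  + (INR n - 1) / r * phi p (Derive u r).

(* Makes the total operator [Derive] meaningful in [radial_plaplacian]. *)
Definition classical_at (p : R) (u : R -> R) (r : R) : Prop :=
  ex_derive u r /\ ex_derive (fun s => phi p (Derive u s)) r.

(* [w] is only meaningful on [0, +oo): the condition w'(0) = 0 is one-sided,
   and no regularity is assumed at [0] beyond it. *)
Definition ivp_solution (n : nat) (p q alpha : R) (w : R -> R) : Prop :=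
  w 0 = 1 /\
  filterlim (fun t => (w t - w 0) / t) (at_right 0) (locally 0) /\
  (forall t, 0 < t ->
     0 < w t /\
     classical_at p w t /\
     radial_plaplacian n p w t = Rpower t alpha / Rpower (w t) q).

Definition bvp_equation_at (n : nat) (p q alpha lambda : R) (u : R -> R)
    (r : R) : Prop :=
  classical_at p u r /\
  radial_plaplacian n p u r
  + lambda * (Rpower r alpha / Rpower (1 - u r) q) = 0.

(* The solution pairs of the boundary value problem are obtained from [w] by
   scaling: substituting u(r) = 1 - w(t r) / w(t) into [bvp_equation_at] gives
   the equation of [ivp_solution] exactly when lambda is [curve_lambda], and
   u(1) = 0, u'(0) = 0 hold automatically. *)
Definition curve_lambda (p q alpha : R) (w : R -> R) (t : R) : R :=
  Rpower t (alpha + p) / Rpower (w t) (p + q - 1).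

Definition curve_u (w : R -> R) (t r : R) : R := 1 - w (t * r) / w t.

Definition solution_curve (p q alpha : R) (w : R -> R) (t : R) : R * R :=
  (curve_lambda p q alpha w t, curve_u w t 0).

Definition changes_sign_at (f : R -> R) (t : R) : Prop :=
  exists eps : R, 0 < eps /\
    (((forall s, t - eps < s < t -> f s < 0) /\
      (forall s, t < s < t + eps -> 0 < f s)) \/
     ((forall s, t - eps < s < t -> 0 < f s) /\
      (forall s, t < s < t + eps -> f s < 0))).

Definition turn_at (c : R -> R * R) (t : R) : Prop :=
  changes_sign_at (Derive (fun s => fst (c s))) t.

Definition infinitely_many_turns (c : R -> R * R) : Prop :=
  forall l : list R, exists t : R, 0 < t /\ turn_at c t /\ ~ In t l.

Definition beta (p q alpha : R) : R := (alpha + p) / (p + q - 1).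

(* The constant for which c0 * t^beta solves the equation of [ivp_solution]
   on t > 0. *)
Definition c0 (n : nat) (p q alpha : R) : R :=
  let b := beta p q alpha in
  Rpower (1 / (Rpower b (p - 1) * ((p - 1) * (b - 1) + INR n - 1)))
         (1 / (p + q - 1)).

Definition lambda0 (n : nat) (p q alpha : R) : R :=
  1 / Rpower (c0 n p q alpha) (p + q - 1).

(* Main.v *)
Require Import Defs.
From Stdlib Require Import Reals List Lra Classical.
From Coquelicot Require Import Coquelicot.

(** The whole statement is read off a planar quadratic system.  In the time
    [s = ln t] the scale-invariant ratios [X = t w'(t) / w(t)] and
    [Y = t ^ (alpha + 1) / (w(t) ^ q * phi (w'(t)))] of the solution [w] of the
    initial value problem satisfy a Lotka-Volterra system with damping,
    [X' = X ((Y - c) / (p - 1) - (X - b))] and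
    [Y' = Y (- q (X - b) - (Y - c))], where [b] is beta and
    [c = (p - 1) (b - 1) + n - 1] ([ivp_lotka_volterra]).  The positivity of w',
    on which the logarithms depend, follows from the divergence form of the
    equation and from w'(0) = 0 ([ivp_flux_pos]).

    Volterra's function
    [q (p - 1) (X - b - b ln (X / b)) + (Y - c - c ln (Y / c))] is a strict
    Lyapunov function of this system: its derivative is
    [- q (p - 1) (X - b) ^ 2 - (Y - c) ^ 2].  It therefore decays exponentially,
    and [(X, Y)] tends to [(b, c)] ([lotka_volterra_converges]).  In these
    variables lambda equals [X ^ (p - 1) * Y], so it tends to
    [b ^ (p - 1) * c], which is lambda0; since [w] is [t ^ b] times a power of
    lambda, the limits of [u(0)] and [u(r)] follow.

    The logarithmic derivative of lambda with respect to [s] is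
    [(p + q - 1) (b - X)].  A turn is thus a crossing of the line [X = b].  The
    third hypothesis on the exponents says precisely that beta exceeds the larger
    root of the quadratic that makes the equilibrium a focus
    ([focus_condition]).  The polar angle about a focus decreases at a rate
    bounded away from 0 near it, so crossings occur at arbitrarily large times
    ([lotka_volterra_oscillates]).  Each crossing is transversal unless the orbit
    sits at the equilibrium, which is impossible because lambda tends to 0 as [t]
    tends to 0 ([ivp_energy_pos]). *)

Open Scope R_scope.

(** * Mean value and differential inequalities *)

(** Lagrange's theorem with the derivative given as a function on the closed
    interval, the form in which derivatives are known below. *)
Lemma mean_value (f df : R -> R) (a b : R) :
  a <= b -> (forall x, a <= x <= b -> is_derive f x (df x)) ->
  exists c, a <= c <= b /\ f b - f a = df c * (b - a).
Proof.
  intros Hab Hd.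
  destruct (MVT_gen f a b df) as [c [Hc E]].
  - intros x Hx. rewrite Rmin_left, Rmax_right in Hx by lra. apply Hd. lra.
  - intros x Hx. rewrite Rmin_left, Rmax_right in Hx by lra.
    apply continuity_pt_filterlim, (ex_derive_continuous f x).
    exists (df x). apply Hd. lra.
  - rewrite Rmin_left, Rmax_right in Hc by lra. now exists c.
Qed.

Lemma nondecreasing_of_derive (f df : R -> R) (a b : R) :
  a <= b ->
  (forall x, a <= x <= b -> is_derive f x (df x)) ->
  (forall x, a <= x <= b -> 0 <= df x) ->
  f a <= f b.
Proof.
  intros Hab Hd Hpos.
  destruct (mean_value f df a b Hab Hd) as [c [Hc E]].
  specialize (Hpos c Hc). nra.
Qed.

Lemma gronwall_upper (f df : R -> R) (k a b : R) :
  a <= b ->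
  (forall x, a <= x <= b -> is_derive f x (df x)) ->
  (forall x, a <= x <= b -> df x <= - k * f x) ->
  f b * exp (k * b) <= f a * exp (k * a).
Proof.
  intros Hab Hd Hle.
  apply Ropp_le_cancel.
  apply (nondecreasing_of_derive (fun x => - (f x * exp (k * x)))
           (fun x => (- df x - k * f x) * exp (k * x))); [exact Hab| |].
  - intros x Hx. specialize (Hd x Hx).
    auto_derive; [now exists (df x)|].
    replace (Derive (fun x0 => f x0) x) with (df x)
      by (symmetry; now apply is_derive_unique).
    ring.
  - intros x Hx. specialize (Hle x Hx).
    apply Rmult_le_pos; [lra|]. apply Rlt_le, exp_pos.
Qed.

Lemma gronwall_lower (f df : R -> R) (k a b : R) :
  a <= b ->
  (forall x, a <= x <= b -> is_derive f x (df x)) ->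
  (forall x, a <= x <= b -> - k * f x <= df x) ->
  f a * exp (k * a) <= f b * exp (k * b).
Proof.
  intros Hab Hd Hle.
  assert (H : - f b * exp (k * b) <= - f a * exp (k * a)).
  { apply (gronwall_upper (fun x => - f x) (fun x => - df x)); [exact Hab| |].
    - intros x Hx. apply (is_derive_opp f x (df x)). now apply Hd.
    - intros x Hx. specialize (Hle x Hx). lra. }
  lra.
Qed.

(** * The Volterra function *)

(** Tangent line of [ln] at 1; both estimates of the divergence from below and
    from above are instances of it. *)
Lemma ln_le_sub_one (x : R) : 0 < x -> ln x <= x - 1.
Proof.
  intros Hx. generalize (exp_ineq1_le (ln x)). rewrite exp_ln by exact Hx. lra.
Qed.

(** The Volterra function, that is [a * (u - 1 - ln u)] at [u = x / a]: convex,
    with its minimum 0 at [x = a]. *)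
Definition divergence (a x : R) : R := x - a - a * ln (x / a).

(** Since [ln u = 2 ln (sqrt u) <= 2 (sqrt u - 1)], one has
    [u - 1 - ln u >= (sqrt u - 1) ^ 2].  Passing to square roots gives a lower
    bound that is valid for all [x > 0], so that small divergence forces [x]
    close to [a] without any a priori bound on [x]. *)
Lemma divergence_ge_sqr_sqrt (a x : R) :
  0 < a -> 0 < x -> (sqrt x - sqrt a) ^ 2 <= divergence a x.
Proof.
  intros Ha Hx. unfold divergence.
  assert (Sa := sqrt_lt_R0 a Ha). assert (Sx := sqrt_lt_R0 x Hx).
  assert (Ea : sqrt a * sqrt a = a) by (apply sqrt_sqrt; lra).
  assert (Ex : sqrt x * sqrt x = x) by (apply sqrt_sqrt; lra).
  set (u := sqrt x / sqrt a).
  assert (Hu : 0 < u) by (apply Rdiv_lt_0_compat; assumption).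
  assert (E : x / a = u * u).
  { unfold u. rewrite <- Ex at 1. rewrite <- Ea at 1. field. lra. }
  rewrite E, ln_mult by assumption.
  assert (L := ln_le_sub_one u Hu).
  assert (Eau : a * u = sqrt x * sqrt a).
  { unfold u. rewrite <- Ea at 1. field. lra. }
  nra.
Qed.

(** Here [- ln (x / a) = ln (a / x) <= a / x - 1]. *)
Lemma divergence_le_sqr (a x : R) :
  0 < a -> 0 < x -> divergence a x <= (x - a) ^ 2 / x.
Proof.
  intros Ha Hx. unfold divergence.
  assert (L := ln_le_sub_one (a / x) (Rdiv_lt_0_compat _ _ Ha Hx)).
  replace (x / a) with (/ (a / x)) by (field; lra).
  rewrite ln_Rinv by (apply Rdiv_lt_0_compat; assumption).
  replace ((x - a) ^ 2 / x) with (x - a + a * (a / x - 1)) by (field; lra).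
  nra.
Qed.

(** The logarithm keeps [x] away from 0 on sublevel sets of the divergence. *)
Lemma lower_bound_of_divergence (a x M : R) :
  0 < a -> 0 < x -> divergence a x <= M -> a * exp (- (M / a) - 1) <= x.
Proof.
  intros Ha Hx HM. unfold divergence in HM.
  assert (Hxa : 0 < x / a) by (apply Rdiv_lt_0_compat; assumption).
  assert (L : - (M / a) - 1 <= ln (x / a)).
  { apply Rmult_le_reg_l with a; [exact Ha|].
    replace (a * (- (M / a) - 1)) with (- M - a) by (field; lra). lra. }
  assert (E : exp (- (M / a) - 1) <= x / a).
  { rewrite <- (exp_ln (x / a)) by exact Hxa.
    destruct L as [L|L]; [left; now apply exp_increasing | right; now rewrite L]. }
  apply (Rmult_le_compat_l a) in E; [|lra].
  replace (a * (x / a)) with x in E by (field; lra). exact E.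
Qed.

(** Write [(x - a) ^ 2] as [(sqrt x + sqrt a) ^ 2 * (sqrt x - sqrt a) ^ 2]; the
    first factor is bounded on a sublevel set. *)
Lemma sqr_le_divergence (a x M : R) :
  0 < a -> 0 < x -> divergence a x <= M ->
  (x - a) ^ 2 <= (2 * sqrt a + sqrt M) ^ 2 * divergence a x.
Proof.
  intros Ha Hx HM.
  assert (S := divergence_ge_sqr_sqrt a x Ha Hx).
  assert (Sa := sqrt_lt_R0 a Ha). assert (Sx := sqrt_lt_R0 x Hx).
  assert (Ea : sqrt a * sqrt a = a) by (apply sqrt_sqrt; lra).
  assert (Ex : sqrt x * sqrt x = x) by (apply sqrt_sqrt; lra).
  assert (HM0 : 0 <= M) by (generalize (pow2_ge_0 (sqrt x - sqrt a)); lra).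
  assert (B : sqrt x - sqrt a <= sqrt M).
  { apply Rle_trans with (Rabs (sqrt x - sqrt a)); [apply Rle_abs|].
    rewrite <- sqrt_Rsqr_abs. apply sqrt_le_1_alt. unfold Rsqr. lra. }
  assert (E : (x - a) ^ 2 = (sqrt x + sqrt a) ^ 2 * (sqrt x - sqrt a) ^ 2).
  { rewrite <- Ex at 1. rewrite <- Ea at 1. ring. }
  rewrite E. apply Rmult_le_compat; try apply pow2_ge_0; [|exact S].
  apply pow_incr. lra.
Qed.

Lemma is_derive_divergence (a : R) (f : R -> R) (s df : R) :
  0 < a -> 0 < f s -> is_derive f s df ->
  is_derive (fun r => divergence a (f r)) s ((f s - a) / f s * df).
Proof.
  intros Ha Hf Hd. unfold divergence.
  auto_derive.
  - repeat split; try now exists df. now apply Rdiv_lt_0_compat.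
  - replace (Derive (fun x => f x) s) with df
      by (symmetry; now apply is_derive_unique).
    field. lra.
Qed.

(** * Convergence of the dissipative Lotka-Volterra system *)

(** The equations are written around the equilibrium [(b, c)]. *)
Definition lotka_volterra (m q b c : R) (X Y : R -> R) : Prop :=
  forall s, 0 < X s /\ 0 < Y s /\
    is_derive X s (X s * ((Y s - c) / m - (X s - b))) /\
    is_derive Y s (Y s * (- q * (X s - b) - (Y s - c))).

(** The weight [q * m] is the one for which the mixed term
    [(X s - b) * (Y s - c)] cancels in the derivative, leaving minus the
    dissipation. *)
Definition energy (m q b c : R) (X Y : R -> R) (s : R) : R :=
  q * m * divergence b (X s) + divergence c (Y s).

Definition dissipation (m q b c : R) (X Y : R -> R) (s : R) : R :=
  q * m * (X s - b) ^ 2 + (Y s - c) ^ 2.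

Lemma is_derive_energy (m q b c : R) (X Y : R -> R) (s : R) :
  0 < m -> 0 < b -> 0 < c -> lotka_volterra m q b c X Y ->
  is_derive (energy m q b c X Y) s (- dissipation m q b c X Y s).
Proof.
  intros Hm Hb Hc H. destruct (H s) as (HX & HY & dX & dY).
  apply (is_derive_divergence b) in dX; [|assumption..].
  apply (is_derive_divergence c) in dY; [|assumption..].
  unfold energy.
  evar_last.
  - apply (is_derive_plus (fun r => q * m * divergence b (X r))
             (fun r => divergence c (Y r))); [|exact dY].
    apply (is_derive_scal (fun r => divergence b (X r)) s (q * m)). exact dX.
  - unfold dissipation, plus; simpl. field. repeat split; lra.
Qed.

Lemma energy_bounds (m q b c : R) (X Y : R -> R) (s : R) :
  0 < m -> 0 < q -> 0 < b -> 0 < c -> lotka_volterra m q b c X Y ->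
  q * m * (sqrt (X s) - sqrt b) ^ 2 <= energy m q b c X Y s /\
  (sqrt (Y s) - sqrt c) ^ 2 <= energy m q b c X Y s /\
  divergence b (X s) <= energy m q b c X Y s / (q * m) /\
  divergence c (Y s) <= energy m q b c X Y s.
Proof.
  intros Hm Hq Hb Hc H. destruct (H s) as (HX & HY & _).
  assert (Hqm : 0 < q * m) by nra.
  assert (S1 := divergence_ge_sqr_sqrt b (X s) Hb HX).
  assert (S2 := divergence_ge_sqr_sqrt c (Y s) Hc HY).
  assert (P1 := pow2_ge_0 (sqrt (X s) - sqrt b)).
  assert (P2 := pow2_ge_0 (sqrt (Y s) - sqrt c)).
  unfold energy. repeat split; try nra.
  apply Rmult_le_reg_l with (q * m); [exact Hqm|].
  replace (q * m * ((q * m * divergence b (X s) + divergence c (Y s)) / (q * m)))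
    with (q * m * divergence b (X s) + divergence c (Y s)) by (field; lra).
  lra.
Qed.

Lemma dissipation_nonneg (m q b c : R) (X Y : R -> R) (s : R) :
  0 < m -> 0 < q -> 0 <= dissipation m q b c X Y s.
Proof.
  intros Hm Hq. unfold dissipation.
  assert (0 < q * m) by nra.
  assert (P1 := pow2_ge_0 (X s - b)).
  assert (P2 := pow2_ge_0 (Y s - c)). nra.
Qed.

Lemma energy_nonincreasing (m q b c : R) (X Y : R -> R) (a s : R) :
  0 < m -> 0 < q -> 0 < b -> 0 < c -> lotka_volterra m q b c X Y ->
  a <= s -> energy m q b c X Y s <= energy m q b c X Y a.
Proof.
  intros Hm Hq Hb Hc H Has.
  apply Ropp_le_cancel.
  apply (nondecreasing_of_derive (fun r => - energy m q b c X Y r)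
           (dissipation m q b c X Y)); [exact Has| |].
  - intros x _. rewrite <- (Ropp_involutive (dissipation m q b c X Y x)).
    apply (is_derive_opp (energy m q b c X Y)). now apply is_derive_energy.
  - intros x _. now apply dissipation_nonneg.
Qed.

(** The energy is controlled by the dissipation: by [divergence_le_sqr] each
    divergence is at most the squared deviation divided by [X] or [Y], and these
    stay above constants [k1], [k2] that depend on the initial energy only. *)
Lemma energy_exponential_decay (m q b c : R) (X Y : R -> R) :
  0 < m -> 0 < q -> 0 < b -> 0 < c -> lotka_volterra m q b c X Y ->
  exists k, 0 < k /\ forall s, 0 <= s ->
    energy m q b c X Y s <= energy m q b c X Y 0 * exp (- k * s).
Proof.
  intros Hm Hq Hb Hc H.
  assert (Hqm : 0 < q * m) by nra.
  set (V := energy m q b c X Y).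
  set (k1 := b * exp (- (V 0 / (q * m) / b) - 1)).
  set (k2 := c * exp (- (V 0 / c) - 1)).
  assert (H1 : 0 < k1) by (apply Rmult_lt_0_compat; [lra|apply exp_pos]).
  assert (H2 : 0 < k2) by (apply Rmult_lt_0_compat; [lra|apply exp_pos]).
  exists (Rmin k1 k2). split; [now apply Rmin_pos|].
  set (k := Rmin k1 k2). intros s Hs.
  assert (G : V s * exp (k * s) <= V 0 * exp (k * 0)).
  { apply (gronwall_upper V (fun r => - dissipation m q b c X Y r)); [exact Hs| |].
    - intros x _. now apply is_derive_energy.
    - intros x Hx. destruct (H x) as (HX & HY & _).
      assert (N : V x <= V 0) by (apply energy_nonincreasing; lra || assumption).
      destruct (energy_bounds m q b c X Y x Hm Hq Hb Hc H) as (_ & _ & B1 & B2).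
      fold V in B1, B2.
      assert (B1' : divergence b (X x) <= V 0 / (q * m)).
      { apply Rle_trans with (1 := B1). apply Rmult_le_compat_r; [|exact N].
        left. now apply Rinv_0_lt_compat. }
      apply lower_bound_of_divergence in B1'; [|assumption..].
      assert (B2' : divergence c (Y x) <= V 0) by lra.
      apply lower_bound_of_divergence in B2'; [|assumption..].
      fold k1 in B1'. fold k2 in B2'.
      assert (Q : forall a y, 0 < a -> 0 < y -> k <= y ->
                k * divergence a y <= (y - a) ^ 2).
      { intros a y Ha Hy Hky.
        assert (L := divergence_le_sqr a y Ha Hy).
        assert (L0 := divergence_ge_sqr_sqrt a y Ha Hy).
        assert (P := pow2_ge_0 (sqrt y - sqrt a)).
        apply Rle_trans with (y * divergence a y).
        - apply Rmult_le_compat_r; lra.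
        - apply (Rmult_le_compat_l y) in L; [|lra].
          replace (y * ((y - a) ^ 2 / y)) with ((y - a) ^ 2) in L by (field; lra).
          exact L. }
      assert (Q1 := Q b (X x) Hb HX (Rle_trans _ _ _ (Rmin_l _ _) B1')).
      assert (Q2 := Q c (Y x) Hc HY (Rle_trans _ _ _ (Rmin_r _ _) B2')).
      apply (Rmult_le_compat_l (q * m)) in Q1; [|lra].
      unfold V, energy, dissipation. lra. }
  rewrite Rmult_0_r, exp_0, Rmult_1_r in G.
  apply Rmult_le_reg_r with (exp (k * s)); [apply exp_pos|].
  rewrite Rmult_assoc, <- exp_plus.
  replace (- k * s + k * s) with 0 by ring.
  now rewrite exp_0, Rmult_1_r.
Qed.

(** An orbit cannot reach the equilibrium in finite time.  On the sublevel set of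
    the initial energy the dissipation is at most a constant times the energy,
    so the energy decays at most exponentially. *)
Lemma energy_positive_forward (m q b c : R) (X Y : R -> R) (a s : R) :
  0 < m -> 0 < q -> 0 < b -> 0 < c -> lotka_volterra m q b c X Y ->
  a <= s -> 0 < energy m q b c X Y a -> 0 < energy m q b c X Y s.
Proof.
  intros Hm Hq Hb Hc H Has Hpos.
  assert (Hqm : 0 < q * m) by nra.
  set (V := energy m q b c X Y) in *.
  set (C1 := (2 * sqrt b + sqrt (V a / (q * m))) ^ 2).
  set (C2 := (2 * sqrt c + sqrt (V a)) ^ 2).
  assert (P1 : 0 <= C1) by apply pow2_ge_0.
  assert (P2 : 0 <= C2) by apply pow2_ge_0.
  set (k := C1 + C2).
  assert (G : V a * exp (k * a) <= V s * exp (k * s)).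
  { apply (gronwall_lower V (fun r => - dissipation m q b c X Y r)); [exact Has| |].
    - intros x _. now apply is_derive_energy.
    - intros x Hx. destruct (H x) as (HX & HY & _).
      assert (N : V x <= V a) by (apply energy_nonincreasing; lra || assumption).
      destruct (energy_bounds m q b c X Y x Hm Hq Hb Hc H) as (_ & _ & B1 & B2).
      fold V in B1, B2.
      assert (B1' : divergence b (X x) <= V a / (q * m)).
      { apply Rle_trans with (1 := B1). apply Rmult_le_compat_r; [|exact N].
        left. now apply Rinv_0_lt_compat. }
      apply sqr_le_divergence in B1'; [|assumption..].
      assert (B2' : divergence c (Y x) <= V a) by lra.
      apply sqr_le_divergence in B2'; [|assumption..].
      fold C1 in B1'. fold C2 in B2'.
      assert (D1 := divergence_ge_sqr_sqrt b (X x) Hb HX).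
      assert (D2 := divergence_ge_sqr_sqrt c (Y x) Hc HY).
      assert (S1 := pow2_ge_0 (sqrt (X x) - sqrt b)).
      assert (S2 := pow2_ge_0 (sqrt (Y x) - sqrt c)).
      apply (Rmult_le_compat_l (q * m)) in B1'; [|lra].
      assert (Z1 : 0 <= C2 * (q * m * divergence b (X x))).
      { apply Rmult_le_pos; [exact P2|]. apply Rmult_le_pos; lra. }
      assert (Z2 : 0 <= C1 * divergence c (Y x)) by (apply Rmult_le_pos; lra).
      unfold V, energy, dissipation, k. lra. }
  assert (E1 := exp_pos (k * a)). assert (E2 := exp_pos (k * s)).
  assert (0 < V a * exp (k * a)) by (apply Rmult_lt_0_compat; assumption).
  apply Rmult_lt_reg_r with (exp (k * s)); [exact E2|]. lra.
Qed.

Lemma is_lim_linear_p_infty (k : R) :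
  0 < k -> is_lim (fun s => k * s) p_infty p_infty.
Proof.
  intros Hk.
  replace p_infty with (Rbar_mult k p_infty) at 2.
  - apply is_lim_scal_l, is_lim_id.
  - apply is_Rbar_mult_unique, is_Rbar_mult_sym.
    now apply is_Rbar_mult_p_infty_pos.
Qed.

(** The limit is taken on the square roots, where [divergence_ge_sqr_sqrt]
    gives the control, and then squared. *)
Lemma is_lim_of_sqr_sqrt (a k : R) (f V : R -> R) :
  0 < a -> 0 < k -> (forall s, 0 < f s) ->
  (forall s, k * (sqrt (f s) - sqrt a) ^ 2 <= V s) ->
  is_lim V p_infty 0 -> is_lim f p_infty a.
Proof.
  intros Ha Hk Hf HV LV.
  assert (LS : is_lim (fun s => sqrt (f s)) p_infty (sqrt a)).
  { apply is_lim_spec. intros eps.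
    apply is_lim_spec in LV.
    assert (He : 0 < k * eps ^ 2).
    { apply Rmult_lt_0_compat; [exact Hk|]. apply pow_lt, cond_pos. }
    destruct (LV (mkposreal _ He)) as [M HM]. exists M. intros s Hs.
    specialize (HM s Hs). specialize (HV s). simpl in HM.
    rewrite Rminus_0_r in HM. apply Rabs_def2 in HM.
    rewrite <- (Rabs_pos_eq eps) by (left; apply cond_pos).
    apply Rsqr_lt_abs_0. unfold Rsqr.
    apply Rmult_lt_reg_l with k; [exact Hk|]. simpl in HV. lra. }
  apply is_lim_ext with (fun s => sqrt (f s) * sqrt (f s)).
  { intros s. apply sqrt_sqrt. left. apply Hf. }
  rewrite <- (sqrt_sqrt a) by lra.
  change (Finite (sqrt a * sqrt a)) with (Rbar_mult (sqrt a) (sqrt a)).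
  apply is_lim_mult; [exact LS|exact LS|exact I].
Qed.

Lemma lotka_volterra_converges (m q b c : R) (X Y : R -> R) :
  0 < m -> 0 < q -> 0 < b -> 0 < c -> lotka_volterra m q b c X Y ->
  is_lim X p_infty b /\ is_lim Y p_infty c.
Proof.
  intros Hm Hq Hb Hc H.
  destruct (energy_exponential_decay m q b c X Y Hm Hq Hb Hc H) as [k [Hk D]].
  assert (LV : is_lim (energy m q b c X Y) p_infty 0).
  { apply is_lim_le_le_loc with (fun _ => 0)
      (fun s => energy m q b c X Y 0 * exp (- k * s)).
    - exists 0. intros s Hs. split.
      + destruct (energy_bounds m q b c X Y s Hm Hq Hb Hc H) as (_ & B & _).
        generalize (pow2_ge_0 (sqrt (Y s) - sqrt c)). lra.
      + apply D. lra.
    - apply is_lim_const.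
    - replace (Finite 0) with (Rbar_mult (energy m q b c X Y 0) 0)
        by (simpl; f_equal; ring).
      apply is_lim_scal_l.
      apply (is_lim_comp exp (fun s => - k * s) p_infty 0 m_infty).
      + apply is_lim_exp_m.
      + apply is_lim_ext with (fun s => - (k * s)); [intros s; ring|].
        apply (is_lim_opp (fun s => k * s) p_infty p_infty).
        now apply is_lim_linear_p_infty.
      + exists 0. intros s _. discriminate. }
  split.
  - apply (is_lim_of_sqr_sqrt b (q * m) X (energy m q b c X Y)); auto.
    + nra.
    + intros s. apply H.
    + intros s. now apply energy_bounds.
  - apply (is_lim_of_sqr_sqrt c 1 Y (energy m q b c X Y)); auto.
    + lra.
    + intros s. apply H.
    + intros s. rewrite Rmult_1_l. now apply energy_bounds.
Qed.

(** * Oscillation around a focus *)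

Lemma is_lim_pos_eventually (f : R -> R) (l : R) :
  is_lim f p_infty l -> 0 < l -> exists M, forall s, M < s -> 0 < f s.
Proof.
  intros Hf Hl. apply is_lim_spec in Hf.
  destruct (Hf (mkposreal l Hl)) as [M HM]. exists M. intros s Hs.
  specialize (HM s Hs). simpl in HM. apply Rabs_def2 in HM. lra.
Qed.

Lemma quadratic_nonneg (a1 a2 a3 x : R) :
  0 < a1 -> a2 ^ 2 <= 4 * a1 * a3 -> 0 <= a1 * x ^ 2 - a2 * x + a3.
Proof.
  intros H1 H.
  assert (P := pow2_ge_0 (2 * a1 * x - a2)).
  apply Rmult_le_reg_l with (4 * a1); [lra|]. nra.
Qed.

(** [atan rho] decreases at rate at least [eps] and takes values in an interval of
    length [PI]. *)
Lemma riccati_interval_bounded (rho drho : R -> R) (eps a b : R) :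
  0 < eps -> a <= b ->
  (forall s, a <= s <= b -> is_derive rho s (drho s)) ->
  (forall s, a <= s <= b -> drho s <= - eps * (1 + rho s ^ 2)) ->
  eps * (b - a) < PI.
Proof.
  intros He Hab Hd Hle.
  assert (M : - (atan (rho a) + eps * a) <= - (atan (rho b) + eps * b)).
  { apply (nondecreasing_of_derive (fun s => - (atan (rho s) + eps * s))
             (fun s => - (drho s / (1 + rho s ^ 2) + eps))); [exact Hab| |].
    - intros s Hs.
      apply (is_derive_opp (fun s => atan (rho s) + eps * s)).
      apply (is_derive_plus (fun s => atan (rho s)) (fun s => eps * s)).
      + evar_last.
        * apply (is_derive_comp atan rho); [apply is_derive_atan|now apply Hd].
        * unfold scal; simpl; unfold mult; simpl. unfold Rsqr. field.
          generalize (pow2_ge_0 (rho s)); lra.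
      + auto_derive; [exact I|ring].
    - intros s Hs. specialize (Hle s Hs).
      assert (P := pow2_ge_0 (rho s)).
      assert (drho s / (1 + rho s ^ 2) <= - eps).
      { apply Rmult_le_reg_r with (1 + rho s ^ 2); [lra|].
        replace (drho s / (1 + rho s ^ 2) * (1 + rho s ^ 2)) with (drho s)
          by (field; lra). exact Hle. }
      lra. }
  assert (B1 := atan_bound (rho a)). assert (B2 := atan_bound (rho b)). lra.
Qed.

(** The slope [rho = (Y - c) / (X - b)], which is the tangent of the polar angle
    about the equilibrium, satisfies the Riccati equation
    [rho' = - (X / m * rho ^ 2 - (X - Y) * rho + q * Y)].  The second bound on
    [eps] says that the quadratic form stays nonnegative after [eps] times
    [1 + rho ^ 2] is subtracted from it. *)
Lemma lotka_volterra_slope_riccati (m q b c eps : R) (X Y : R -> R) (s : R) :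
  0 < m -> lotka_volterra m q b c X Y -> X s <> b ->
  0 < X s / m - eps ->
  (X s - Y s) ^ 2 <= 4 * (X s / m - eps) * (q * Y s - eps) ->
  exists d, is_derive (fun r => (Y r - c) / (X r - b)) s d /\
    d <= - eps * (1 + ((Y s - c) / (X s - b)) ^ 2).
Proof.
  intros Hm H Hne H1 H2. destruct (H s) as (HX & HY & dX & dY).
  set (rho := (Y s - c) / (X s - b)).
  exists (- (X s / m * rho ^ 2 - (X s - Y s) * rho + q * Y s)). split.
  - auto_derive.
    + repeat split; try (eexists; eassumption). lra.
    + replace (Derive (fun x => X x) s) with (X s * ((Y s - c) / m - (X s - b)))
        by (symmetry; now apply is_derive_unique).
      replace (Derive (fun x => Y x) s)
        with (Y s * (- q * (X s - b) - (Y s - c)))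
        by (symmetry; now apply is_derive_unique).
      unfold rho. field. lra.
  - assert (Q := quadratic_nonneg _ _ _ rho H1 H2). lra.
Qed.

(** The hypothesis says that the linearization at [(b, c)] has non-real
    eigenvalues.  The orbit converges to [(b, c)], so the discriminant condition
    of [lotka_volterra_slope_riccati] holds with a fixed [eps] from some time
    on; an interval of length [PI / eps] on which [X] avoids [b] would then
    contradict [riccati_interval_bounded]. *)
Lemma lotka_volterra_oscillates (m q b c : R) (X Y : R -> R) (S : R) :
  0 < m -> 0 < q -> 0 < b -> 0 < c -> lotka_volterra m q b c X Y ->
  (b - c) ^ 2 < 4 * (b / m) * (q * c) ->
  exists s, S < s /\ X s = b.
Proof.
  intros Hm Hq Hb Hc H Hfocus.
  destruct (lotka_volterra_converges m q b c X Y Hm Hq Hb Hc H) as [LX LY].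
  assert (Hbm : 0 < b / m) by now apply Rdiv_lt_0_compat.
  assert (Hqc : 0 < q * c) by now apply Rmult_lt_0_compat.
  set (D := 4 * (b / m) * (q * c) - (b - c) ^ 2).
  (* With this choice the linear term in [eps] costs half of the gap [D], and
     [eps < b / m] follows from [D <= 4 * (b / m) * (q * c)]. *)
  set (eps := D / (8 * (b / m + q * c))).
  assert (HD : 0 < D) by (unfold D; lra).
  assert (Heps : 0 < eps) by (apply Rdiv_lt_0_compat; lra).
  assert (Eeps : 8 * eps * (b / m + q * c) = D) by (unfold eps; field_simplify_eq; nra).
  assert (Hsmall : 0 < b / m - eps).
  { assert (0 <= (b - c) ^ 2) by apply pow2_ge_0. unfold D in Eeps. nra. }
  assert (Hdisc : 0 < 4 * (b / m - eps) * (q * c - eps) - (b - c) ^ 2).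
  { replace (4 * (b / m - eps) * (q * c - eps) - (b - c) ^ 2)
      with (D - 4 * eps * (b / m + q * c) + 4 * eps ^ 2) by (unfold D; ring).
    assert (0 < eps ^ 2) by now apply pow_lt. lra. }
  assert (LA : is_lim (fun s => X s / m - eps) p_infty (b / m - eps)).
  { apply (is_lim_minus' (fun s => X s / m) (fun _ => eps)).
    - apply (is_lim_scal_r X (/ m) p_infty b). exact LX.
    - apply is_lim_const. }
  assert (LB : is_lim (fun s => 4 * (X s / m - eps) * (q * Y s - eps)
                                - (X s - Y s) ^ 2) p_infty
                 (4 * (b / m - eps) * (q * c - eps) - (b - c) ^ 2)).
  { assert (LM : forall f g (u v : R), is_lim f p_infty u -> is_lim g p_infty v ->
              is_lim (fun s => f s * g s) p_infty (u * v)).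
    { intros f g u v Hf Hg.
      apply (is_lim_mult f g p_infty u v); [exact Hf|exact Hg|exact I]. }
    apply is_lim_minus'.
    - apply LM.
      + apply LM; [apply is_lim_const|exact LA].
      + apply is_lim_minus'; [|apply is_lim_const].
        apply LM; [apply is_lim_const|exact LY].
    - assert (LXY : is_lim (fun s => X s - Y s) p_infty (b - c))
        by now apply is_lim_minus'.
      simpl. apply LM; [exact LXY|]. apply LM; [exact LXY|apply is_lim_const]. }
  destruct (is_lim_pos_eventually _ _ LA Hsmall) as [M1 HM1].
  destruct (is_lim_pos_eventually _ _ LB Hdisc) as [M2 HM2].
  apply NNPP. intros Hno.
  set (a := Rmax S (Rmax M1 M2) + 1).
  assert (Ha : S < a /\ M1 < a /\ M2 < a).
  { unfold a. generalize (Rmax_l S (Rmax M1 M2)) (Rmax_r S (Rmax M1 M2))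
      (Rmax_l M1 M2) (Rmax_r M1 M2). lra. }
  set (rho := fun r : R => (Y r - c) / (X r - b)).
  assert (R : forall s, a <= s -> exists d,
            is_derive rho s d /\ d <= - eps * (1 + rho s ^ 2)).
  { intros s Hs. apply (lotka_volterra_slope_riccati m q b c eps X Y); auto.
    - intros E. apply Hno. exists s. split; [lra|exact E].
    - apply HM1. lra.
    - specialize (HM2 s). lra. }
  assert (HPI := PI_RGT_0).
  assert (B : eps * (a + PI / eps - a) < PI).
  { apply (riccati_interval_bounded rho (Derive rho)); [exact Heps| | |].
    - assert (0 < PI / eps) by now apply Rdiv_lt_0_compat. lra.
    - intros s Hs. destruct (R s) as [d [Hd _]]; [lra|].
      apply Derive_correct. now exists d.
    - intros s Hs. destruct (R s) as [d [Hd Hle]]; [lra|].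
      now rewrite (is_derive_unique rho s d Hd). }
  replace (eps * (a + PI / eps - a)) with PI in B by (field; lra). lra.
Qed.

(** * Sign changes *)

Lemma changes_sign_at_simple_zero (f : R -> R) (t d : R) :
  is_derive f t d -> f t = 0 -> d <> 0 -> changes_sign_at f t.
Proof.
  intros Hd H0 Hne.
  apply is_derive_Reals in Hd.
  destruct (Hd (Rabs d) (Rabs_pos_lt d Hne)) as [eps He].
  assert (Q : forall s, s <> t -> Rabs (s - t) < eps -> 0 < d * (f s / (s - t))).
  { intros s Hs Hlt. specialize (He (s - t)).
    assert (Hst : s - t <> 0) by lra. specialize (He Hst Hlt).
    replace (t + (s - t)) with s in He by ring. rewrite H0, Rminus_0_r in He.
    apply Rsqr_lt_abs_1 in He. unfold Rsqr in He.
    set (z := f s / (s - t)) in *. nra. }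
  assert (Q' : forall s, s <> t -> Rabs (s - t) < eps ->
            exists z, 0 < d * z /\ f s = z * (s - t)).
  { intros s Hs Hlt. exists (f s / (s - t)). split; [now apply Q|]. field. lra. }
  exists eps. split; [apply cond_pos|].
  destruct (Rdichotomy _ _ Hne) as [Hneg|Hpos]; [right|left]; split; intros s Hs;
    (destruct (Q' s) as [z [Hz Ez]];
      [lra | apply Rabs_def1; lra | rewrite Ez; nra]).
Qed.

(** Positivity of the factor is only available for positive arguments, whence the
    restriction on [t]. *)
Lemma changes_sign_at_mult_pos (f h k : R -> R) (t : R) :
  0 < t -> (forall s, 0 < s -> 0 < k s /\ h s = k s * f s) ->
  changes_sign_at f t -> changes_sign_at h t.
Proof.
  intros Ht Hk [eps [He Hf]].
  exists (Rmin eps t). split; [now apply Rmin_pos|].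
  assert (M1 := Rmin_l eps t). assert (M2 := Rmin_r eps t).
  destruct Hf as [[Hl Hr]|[Hl Hr]]; [left|right]; split; intros s Hs;
    (destruct (Hk s) as [Kpos Ks]; [lra|]; rewrite Ks);
    [specialize (Hl s)|specialize (Hr s)|specialize (Hl s)|specialize (Hr s)]; nra.
Qed.

(** * The initial value problem *)

Lemma phi_of_pos (p v : R) : 0 < v -> phi p v = Rpower v (p - 1).
Proof.
  intros Hv. unfold phi. rewrite Rabs_pos_eq by lra.
  replace (p - 1) with (1 + (p - 2)) by ring.
  now rewrite Rpower_plus, Rpower_1.
Qed.

Lemma phi_opp (p v : R) : phi p (- v) = - phi p v.
Proof. unfold phi. rewrite Rabs_Ropp. ring. Qed.

Lemma pos_of_phi_pos (p v : R) : 0 < phi p v -> 0 < v.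
Proof.
  unfold phi. intros H.
  assert (E : 0 < Rpower (Rabs v) (p - 2)) by apply exp_pos. nra.
Qed.

Lemma lower_bound_of_phi (p v k : R) :
  1 < p -> 0 < k -> k <= phi p v -> Rpower k (1 / (p - 1)) <= v.
Proof.
  intros Hp Hk H.
  assert (Hv : 0 < v) by (apply pos_of_phi_pos with p; lra).
  rewrite phi_of_pos in H by exact Hv.
  replace v with (Rpower (Rpower v (p - 1)) (1 / (p - 1))).
  - apply Rle_Rpower_l; [|lra]. left. apply Rdiv_lt_0_compat; lra.
  - rewrite Rpower_mult. replace ((p - 1) * (1 / (p - 1))) with 1 by (field; lra).
    now apply Rpower_1.
Qed.

(** The one-sided condition w'(0) = 0 is the only information on [w] near 0; it also
    carries the continuity of [w] at 0 from the right. *)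
Lemma ivp_flat_start (n : nat) (p q alpha : R) (w : R -> R) (eps : R) :
  ivp_solution n p q alpha w -> 0 < eps ->
  exists d, 0 < d /\ forall t, 0 < t < d -> Rabs (w t - 1) < eps * t.
Proof.
  intros [H0 [Hlim _]] He.
  destruct (Hlim (ball 0 (mkposreal _ He)) (locally_ball 0 (mkposreal _ He)))
    as [d Hd].
  exists d. split; [apply cond_pos|]. intros t Ht.
  assert (B : ball 0 (mkposreal _ He) ((w t - w 0) / t)).
  { apply Hd; [|lra]. unfold ball; simpl; unfold AbsRing_ball, abs, minus, plus, opp; simpl.
    apply Rabs_def1; lra. }
  unfold ball in B; simpl in B; unfold AbsRing_ball, abs, minus, plus, opp in B;
    simpl in B.
  rewrite H0 in B. replace (w t - 1) with (((w t - 1) / t + - 0) * t) by (field; lra).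
  rewrite Rabs_mult, (Rabs_pos_eq t) by lra.
  apply Rmult_lt_compat_r; [lra|exact B].
Qed.

Definition flux (p : R) (w : R -> R) (t : R) : R := phi p (Derive w t).

Lemma ivp_is_derive_flux (n : nat) (p q alpha : R) (w : R -> R) (t : R) :
  ivp_solution n p q alpha w -> 0 < t ->
  is_derive (flux p w) t
    (Rpower t alpha / Rpower (w t) q - (INR n - 1) / t * flux p w t).
Proof.
  intros [_ [_ H]] Ht. destruct (H t Ht) as (Hw & [_ Hd] & E).
  unfold radial_plaplacian in E. rewrite <- E.
  replace (_ + _ - _) with (Derive (flux p w) t) by (unfold flux; ring).
  now apply Derive_correct.
Qed.

(** The operator is in divergence form: the derivative of [t ^ (n - 1)] times the
    flux is [t ^ (n - 1)] times the positive right-hand side. *)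
Lemma ivp_weighted_flux_increasing (n : nat) (p q alpha : R) (w : R -> R) (a b : R) :
  ivp_solution n p q alpha w -> 0 < a < b ->
  Rpower a (INR n - 1) * flux p w a < Rpower b (INR n - 1) * flux p w b.
Proof.
  intros H Hab.
  destruct (mean_value (fun t => Rpower t (INR n - 1) * flux p w t)
    (fun t => Rpower t (INR n - 1) * (Rpower t alpha / Rpower (w t) q)) a b)
    as [c [Hc E]]; [lra| |].
  - intros t Ht. assert (D := ivp_is_derive_flux n p q alpha w t H ltac:(lra)).
    unfold Rpower at 1. auto_derive.
    + split; [lra|]. split; [eexists; exact D|exact I].
    + replace (Derive (fun x => flux p w x) t)
        with (Rpower t alpha / Rpower (w t) q - (INR n - 1) / t * flux p w t)
        by (symmetry; now apply is_derive_unique).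
      unfold Rdiv. fold (Rpower t (INR n - 1)). ring.
  - assert (P : 0 < Rpower c (INR n - 1) * (Rpower c alpha / Rpower (w c) q)).
    { apply Rmult_lt_0_compat; [apply exp_pos|].
      apply Rdiv_lt_0_compat; apply exp_pos. }
    nra.
Qed.

(** If the flux were nonpositive at [t], the weighted flux would be negative and
    bounded away from 0 on (0, t / 2], and because [n >= 1] so would be the flux
    itself.  Then [w] would decrease at a rate at least [k > 0] all the way to 0,
    which w'(0) = 0 forbids. *)
Lemma ivp_flux_pos (n : nat) (p q alpha : R) (w : R -> R) (t : R) :
  (1 <= n)%nat -> 1 < p -> ivp_solution n p q alpha w -> 0 < t -> 0 < flux p w t.
Proof.
  intros Hn Hp H Ht.
  assert (HN : 1 <= INR n) by (apply (le_INR 1 n); exact Hn).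
  apply Rnot_le_lt. intros Hneg.
  set (a := t / 2).
  assert (Ha : 0 < flux p (fun s => - w s) a).
  { unfold flux. rewrite Derive_opp, phi_opp. fold (flux p w a).
    assert (M := ivp_weighted_flux_increasing n p q alpha w a t H ltac:(unfold a; lra)).
    assert (P1 : 0 < Rpower a (INR n - 1)) by apply exp_pos.
    assert (P2 : 0 < Rpower t (INR n - 1)) by apply exp_pos.
    nra. }
  assert (Eopp : forall s, flux p (fun s => - w s) s = - flux p w s).
  { intros s. unfold flux. now rewrite Derive_opp, phi_opp. }
  set (k := Rpower (flux p (fun s => - w s) a) (1 / (p - 1))).
  assert (Hk : 0 < k) by apply exp_pos.
  assert (Slope : forall s, 0 < s <= a -> Derive w s <= - k).
  { intros s Hs.
    assert (K : k <= Derive (fun r => - w r) s).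
    { apply lower_bound_of_phi; [exact Hp|exact Ha|].
      fold (flux p (fun r => - w r) s). rewrite !Eopp in *.
      destruct (Req_dec s a) as [->|Hsa]; [lra|].
      assert (M := ivp_weighted_flux_increasing n p q alpha w s a H ltac:(lra)).
      assert (P1 : 0 < Rpower s (INR n - 1)) by apply exp_pos.
      assert (P2 : Rpower s (INR n - 1) <= Rpower a (INR n - 1))
        by (apply Rle_Rpower_l; lra).
      nra. }
    rewrite Derive_opp in K. lra. }
  destruct (ivp_flat_start n p q alpha w (k / 4) H ltac:(lra)) as [d [Hd Flat]].
  set (s := Rmin a d / 2).
  assert (Hs : 0 < s /\ s < a /\ s < d).
  { unfold s. assert (0 < Rmin a d) by (apply Rmin_pos; unfold a in *; lra).
    generalize (Rmin_l a d) (Rmin_r a d). lra. }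
  (* On [s / 2, s] the slope bound gives a drop of at least [k * s / 2], while
     the flat start allows at most [(k / 4) * (s + s / 2)]. *)
  destruct (mean_value w (Derive w) (s / 2) s) as [c [Hc E]]; [lra| |].
  - intros x Hx. apply Derive_correct.
    destruct H as [_ [_ H]]. apply (H x). lra.
  - specialize (Slope c ltac:(lra)).
    assert (F1 := Flat s ltac:(lra)). assert (F2 := Flat (s / 2) ltac:(lra)).
    apply Rabs_def2 in F1. apply Rabs_def2 in F2. nra.
Qed.

(** * Reduction to the Lotka-Volterra system *)

Definition log_profile (w : R -> R) (s : R) : R := ln (w (exp s)).
Definition log_flux (p : R) (w : R -> R) (s : R) : R := ln (flux p w (exp s)).

(** With [t = exp s] this is [t w'(t) / w(t)], because [exp (log_flux p w s)] is the
    power [p - 1] of w'(t).  Expressing it through the flux makes it differentiable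
    by the equation alone. *)
Definition growth_ratio (p : R) (w : R -> R) (s : R) : R :=
  exp (s + log_flux p w s / (p - 1) - log_profile w s).

(** With [t = exp s] this is [t ^ (alpha + 1) / w(t) ^ q] divided by the flux, the
    ratio of the right-hand side of the equation to [flux / t]. *)
Definition forcing_ratio (p q alpha : R) (w : R -> R) (s : R) : R :=
  exp ((alpha + 1) * s - q * log_profile w s - log_flux p w s).

Lemma is_derive_log_profile (n : nat) (p q alpha : R) (w : R -> R) (s : R) :
  (1 <= n)%nat -> 1 < p -> ivp_solution n p q alpha w ->
  is_derive (log_profile w) s (growth_ratio p w s).
Proof.
  intros Hn Hp H.
  assert (Hs := exp_pos s).
  assert (F := ivp_flux_pos n p q alpha w (exp s) Hn Hp H Hs).
  destruct H as [_ [_ H]]. destruct (H _ Hs) as (Hw & [Hd _] & _).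
  assert (D : 0 < Derive w (exp s)) by (apply pos_of_phi_pos with p; exact F).
  unfold log_profile at 1. auto_derive.
  - repeat split; assumption.
  - replace (Derive (fun x => w x) (exp s)) with (Derive w (exp s)) by reflexivity.
    unfold growth_ratio, log_flux, flux, log_profile.
    rewrite phi_of_pos by exact D. unfold Rpower. rewrite ln_exp.
    replace ((p - 1) * ln (Derive w (exp s)) / (p - 1))
      with (ln (Derive w (exp s))) by (field; lra).
    unfold Rminus. rewrite !exp_plus, exp_Ropp, !exp_ln by assumption. ring.
Qed.

Lemma is_derive_log_flux (n : nat) (p q alpha : R) (w : R -> R) (s : R) :
  (1 <= n)%nat -> 1 < p -> ivp_solution n p q alpha w ->
  is_derive (log_flux p w) s (forcing_ratio p q alpha w s - (INR n - 1)).
Proof.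
  intros Hn Hp H.
  assert (Hs := exp_pos s).
  assert (F := ivp_flux_pos n p q alpha w (exp s) Hn Hp H Hs).
  assert (D := ivp_is_derive_flux n p q alpha w (exp s) H Hs).
  unfold log_flux at 1. auto_derive.
  - split; [eexists; exact D|]. split; [exact F|exact I].
  - replace (Derive (fun x => flux p w x) (exp s))
      with (Rpower (exp s) alpha / Rpower (w (exp s)) q
            - (INR n - 1) / exp s * flux p w (exp s))
      by (symmetry; now apply is_derive_unique).
    unfold forcing_ratio, log_flux, log_profile, Rpower. rewrite ln_exp.
    replace ((alpha + 1) * s - q * ln (w (exp s)) - ln (flux p w (exp s)))
      with (s + alpha * s + - (q * ln (w (exp s))) + - ln (flux p w (exp s))) by ring.
    rewrite !exp_plus, !exp_Ropp, !exp_ln by assumption.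
    field. assert (E := exp_pos (q * ln (w (exp s)))). repeat split; lra.
Qed.

(** The equation of [w] is invariant under the scaling that replaces w(t) by
    [w (k * t) / k ^ beta], and so are the two ratios; in logarithmic time this
    scaling is a translation, so the system they satisfy is autonomous.  The power solution [c0 * t ^ beta] is the interior equilibrium. *)
Lemma ivp_lotka_volterra (n : nat) (p q alpha : R) (w : R -> R) :
  (1 <= n)%nat -> 1 < p -> 0 < q -> ivp_solution n p q alpha w ->
  lotka_volterra (p - 1) q (beta p q alpha)
    ((p - 1) * (beta p q alpha - 1) + INR n - 1)
    (growth_ratio p w) (forcing_ratio p q alpha w).
Proof.
  intros Hn Hp Hq H s.
  assert (Dv := is_derive_log_profile n p q alpha w s Hn Hp H).
  assert (Dg := is_derive_log_flux n p q alpha w s Hn Hp H).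
  assert (Ev : Derive (fun x => log_profile w x) s = growth_ratio p w s)
    by now apply is_derive_unique.
  assert (Eg : Derive (fun x => log_flux p w x) s
               = forcing_ratio p q alpha w s - (INR n - 1))
    by now apply is_derive_unique.
  split; [apply exp_pos|]. split; [apply exp_pos|]. split.
  - apply is_derive_ext with
      (fun r => exp (r + log_flux p w r / (p - 1) - log_profile w r));
      [reflexivity|].
    auto_derive.
    + repeat split; eexists; eassumption.
    + rewrite Ev, Eg. fold (Rdiv (log_flux p w s) (p - 1)).
      fold (Rminus (s + log_flux p w s / (p - 1)) (log_profile w s)).
      fold (growth_ratio p w s). unfold beta. field. lra.
  - apply is_derive_ext with
      (fun r => exp ((alpha + 1) * r - q * log_profile w r - log_flux p w r));
      [reflexivity|].
    auto_derive.
    + repeat split; eexists; eassumption.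
    + rewrite Ev, Eg.
      fold (Rminus ((alpha + 1) * s) (q * log_profile w s)).
      fold (Rminus ((alpha + 1) * s - q * log_profile w s) (log_flux p w s)).
      fold (forcing_ratio p q alpha w s). unfold beta. field. lra.
Qed.

(** * Lambda along the solution curve *)

Definition log_lambda (p q alpha : R) (w : R -> R) (s : R) : R :=
  (alpha + p) * s - (p + q - 1) * log_profile w s.

Lemma curve_lambda_exp (p q alpha : R) (w : R -> R) (t : R) :
  0 < t -> curve_lambda p q alpha w t = exp (log_lambda p q alpha w (ln t)).
Proof.
  intros Ht. unfold curve_lambda, log_lambda, log_profile, Rpower.
  rewrite exp_ln by exact Ht. unfold Rminus. rewrite exp_plus, exp_Ropp.
  reflexivity.
Qed.

(** Lambda is [X ^ (p - 1) * Y] in terms of the two ratios, hence a function of the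
    Lotka-Volterra orbit; its limit is the value at the equilibrium. *)
Lemma log_lambda_ratios (p q alpha : R) (w : R -> R) (s : R) :
  1 < p ->
  log_lambda p q alpha w s =
    (p - 1) * ln (growth_ratio p w s) + ln (forcing_ratio p q alpha w s).
Proof.
  intros Hp. unfold growth_ratio, forcing_ratio, log_lambda. rewrite !ln_exp.
  field. lra.
Qed.

Lemma is_derive_log_lambda (n : nat) (p q alpha : R) (w : R -> R) (s : R) :
  (1 <= n)%nat -> 1 < p -> 0 < q -> ivp_solution n p q alpha w ->
  is_derive (log_lambda p q alpha w) s
    ((p + q - 1) * (beta p q alpha - growth_ratio p w s)).
Proof.
  intros Hn Hp Hq H.
  assert (Dv := is_derive_log_profile n p q alpha w s Hn Hp H).
  assert (Ev : Derive (fun x => log_profile w x) s = growth_ratio p w s)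
    by now apply is_derive_unique.
  unfold log_lambda. auto_derive.
  - eexists; exact Dv.
  - rewrite Ev. unfold beta. field. lra.
Qed.

(** Turns of the curve are crossings of the line [X = beta] by the orbit. *)
Lemma Derive_curve_lambda (n : nat) (p q alpha : R) (w : R -> R) (t : R) :
  (1 <= n)%nat -> 1 < p -> 0 < q -> ivp_solution n p q alpha w -> 0 < t ->
  Derive (curve_lambda p q alpha w) t =
    curve_lambda p q alpha w t * (p + q - 1) / t
    * (beta p q alpha - growth_ratio p w (ln t)).
Proof.
  intros Hn Hp Hq H Ht. apply is_derive_unique.
  apply (is_derive_ext_loc (fun r => exp (log_lambda p q alpha w (ln r)))).
  - apply (locally_interval _ t 0 p_infty); [exact Ht|exact I|].
    intros r Hr _. symmetry. now apply curve_lambda_exp.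
  - assert (D := is_derive_log_lambda n p q alpha w (ln t) Hn Hp Hq H).
    auto_derive.
    + split; [eexists; exact D|]. split; [exact Ht|exact I].
    + replace (Derive (fun x => log_lambda p q alpha w x) (ln t))
        with ((p + q - 1) * (beta p q alpha - growth_ratio p w (ln t)))
        by (symmetry; now apply is_derive_unique).
      rewrite curve_lambda_exp by exact Ht. field. lra.
Qed.

(** The orbit is not the equilibrium: otherwise, by
    [energy_positive_forward], it would be at the equilibrium at all earlier
    times, and lambda would be constant near [t = 0]; but lambda(t) tends to 0
    there, because [w] stays near 1. *)
Lemma ivp_energy_pos (n : nat) (p q alpha : R) (w : R -> R) (s : R) :
  (1 <= n)%nat -> 1 < p -> 0 < q -> 0 < alpha -> ivp_solution n p q alpha w ->
  0 < (p - 1) * (beta p q alpha - 1) + INR n - 1 ->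
  0 < energy (p - 1) q (beta p q alpha)
        ((p - 1) * (beta p q alpha - 1) + INR n - 1)
        (growth_ratio p w) (forcing_ratio p q alpha w) s.
Proof.
  intros Hn Hp Hq Hal H Hc.
  set (b := beta p q alpha) in *. set (c := (p - 1) * (b - 1) + INR n - 1) in *.
  assert (Hm : 0 < p - 1) by lra.
  assert (Hqm : 0 < q * (p - 1)) by now apply Rmult_lt_0_compat.
  assert (Hb : 0 < b) by (apply Rdiv_lt_0_compat; lra).
  assert (LV := ivp_lotka_volterra n p q alpha w Hn Hp Hq H).
  fold b in LV. fold c in LV.
  set (l := (p - 1) * ln b + ln c).
  destruct (ivp_flat_start n p q alpha w 1 H ltac:(lra)) as [d [Hd Flat]].
  set (d' := Rmin d (1 / 2) / 2).
  assert (Hd' : 0 < d' /\ d' < d /\ d' < 1 / 2).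
  { unfold d'. assert (0 < Rmin d (1 / 2)) by (apply Rmin_pos; lra).
    generalize (Rmin_l d (1 / 2)) (Rmin_r d (1 / 2)). lra. }
  (* Below this time [log_lambda] is less than its equilibrium value [l],
     as long as [w > 1 / 2]. *)
  set (k := (l + (p + q - 1) * ln (1 / 2) - 1) / (alpha + p)).
  set (a := Rmin s (Rmin (ln d') k)).
  assert (Ha : a <= s /\ a <= ln d' /\ a <= k).
  { unfold a. generalize (Rmin_l s (Rmin (ln d') k)) (Rmin_r s (Rmin (ln d') k))
      (Rmin_l (ln d') k) (Rmin_r (ln d') k). lra. }
  apply (energy_positive_forward (p - 1) q b c _ _ a s); auto; [lra|].
  apply Rnot_le_lt. intros Hle.
  destruct (energy_bounds (p - 1) q b c _ _ a Hm Hq Hb Hc LV) as (B1 & B2 & _).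
  destruct (LV a) as (HX & HY & _).
  set (x := growth_ratio p w a) in *. set (y := forcing_ratio p q alpha w a) in *.
  assert (SQ : forall u v, 0 < u -> 0 < v -> (sqrt u - sqrt v) ^ 2 <= 0 -> u = v).
  { intros u v Hu Hv S. apply sqrt_inj; try lra.
    assert (Z := pow2_ge_0 (sqrt u - sqrt v)).
    assert (Z' : (sqrt u - sqrt v) * (sqrt u - sqrt v) = 0) by lra.
    apply Rmult_integral in Z'. lra. }
  assert (Ex : x = b).
  { apply SQ; [exact HX|exact Hb|]. apply Rmult_le_reg_l with (1 := Hqm). lra. }
  assert (Ey : y = c) by (apply SQ; [exact HY|exact Hc|lra]).
  assert (E := log_lambda_ratios p q alpha w a Hp).
  fold x in E. fold y in E. rewrite Ex, Ey in E. fold l in E.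
  assert (Hea : 0 < exp a <= d').
  { split; [apply exp_pos|]. rewrite <- (exp_ln d') by lra.
    destruct (Req_dec a (ln d')) as [->|]; [lra|]. left. apply exp_increasing. lra. }
  assert (F := Flat (exp a) ltac:(lra)). apply Rabs_def2 in F.
  assert (Hv : ln (1 / 2) < log_profile w a).
  { unfold log_profile. apply ln_increasing; lra. }
  assert (Hk : (alpha + p) * a <= l + (p + q - 1) * ln (1 / 2) - 1).
  { apply Rle_trans with ((alpha + p) * k).
    - apply Rmult_le_compat_l; lra.
    - right. unfold k. field. lra. }
  unfold log_lambda in E.
  assert ((p + q - 1) * ln (1 / 2) <= (p + q - 1) * log_profile w a)
    by (apply Rmult_le_compat_l; lra).
  lra.
Qed.

(** At a crossing [X = beta] the derivative of [X] is
    [beta * (Y - c) / (p - 1)], and [Y <> c] because the energy is positive; so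
    every crossing is transversal. *)
Lemma turn_at_zero_of_slope (n : nat) (p q alpha : R) (w : R -> R) (s : R) :
  (1 <= n)%nat -> 1 < p -> 0 < q -> 0 < alpha -> ivp_solution n p q alpha w ->
  0 < (p - 1) * (beta p q alpha - 1) + INR n - 1 ->
  growth_ratio p w s = beta p q alpha ->
  turn_at (solution_curve p q alpha w) (exp s).
Proof.
  intros Hn Hp Hq Hal H Hc Hs.
  assert (V := ivp_energy_pos n p q alpha w s Hn Hp Hq Hal H Hc).
  assert (LV := ivp_lotka_volterra n p q alpha w Hn Hp Hq H).
  set (b := beta p q alpha) in *. set (c := (p - 1) * (b - 1) + INR n - 1) in *.
  assert (Hb : 0 < b) by (apply Rdiv_lt_0_compat; lra).
  destruct (LV s) as (_ & _ & DX & _).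
  set (y := forcing_ratio p q alpha w s) in *.
  assert (Hy : y <> c).
  { intros E. unfold energy in V. fold y in V. rewrite Hs, E in V.
    unfold divergence in V.
    replace (b / b) with 1 in V by (field; lra).
    replace (c / c) with 1 in V by (field; lra). rewrite ln_1 in V. lra. }
  unfold turn_at. simpl.
  apply (changes_sign_at_mult_pos (fun t => b - growth_ratio p w (ln t)) _
           (fun t => curve_lambda p q alpha w t * (p + q - 1) / t)).
  - apply exp_pos.
  - intros t Ht. split; [|now apply (Derive_curve_lambda n)].
    apply Rdiv_lt_0_compat; [|exact Ht]. apply Rmult_lt_0_compat; [|lra].
    rewrite curve_lambda_exp by exact Ht. apply exp_pos.
  - apply (changes_sign_at_simple_zero _ _ (- (/ exp s * (b * ((y - c) / (p - 1)))))).
    + assert (P := exp_pos s). rewrite <- (ln_exp s) in DX. auto_derive.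
      * split; [eexists; exact DX|]. split; [exact P|exact I].
      * replace (Derive (fun x => growth_ratio p w x) (ln (exp s)))
          with (growth_ratio p w (ln (exp s)) *
            ((y - c) / (p - 1)
             - (growth_ratio p w (ln (exp s)) - b)))
          by (symmetry; now apply is_derive_unique).
        rewrite ln_exp, Hs. field. lra.
    + rewrite ln_exp, Hs. ring.
    + apply Ropp_neq_0_compat. apply Rmult_integral_contrapositive_currified.
      * apply Rinv_neq_0_compat. generalize (exp_pos s). lra.
      * apply Rmult_integral_contrapositive_currified; [lra|].
        unfold Rdiv. apply Rmult_integral_contrapositive_currified; [lra|].
        apply Rinv_neq_0_compat. lra.
Qed.

(** * Infinitely many turns *)

(** Multiplied by [p - 1], the inequality becomes
    [0 < A * b ^ 2 + 2 * B * b - (p - 1) * (N - p) ^ 2] with [A > 0], and the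
    lower bound assumed for [b] is the larger root of this quadratic. *)
Lemma focus_condition (N p q b : R) :
  1 < p -> 0 < q -> 4 * q - (p - 2) ^ 2 > 0 ->
  b > ((p - N) * (2 * q - p ^ 2 + 3 * p - 2)
        + 2 * Rabs (N - p) * sqrt (q * (p + q - 1)))
     / ((p - 1) * (4 * q - (p - 2) ^ 2)) ->
  (b - ((p - 1) * (b - 1) + N - 1)) ^ 2
  < 4 * (b / (p - 1)) * (q * ((p - 1) * (b - 1) + N - 1)).
Proof.
  intros Hp Hq HD Hb.
  set (A := (p - 1) * (4 * q - (p - 2) ^ 2)) in *.
  set (B := (N - p) * (2 * q - p ^ 2 + 3 * p - 2)).
  set (r := 2 * Rabs (N - p) * sqrt (q * (p + q - 1))) in *.
  assert (HA : 0 < A) by (apply Rmult_lt_0_compat; lra).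
  assert (Hr : 0 <= r).
  { unfold r. apply Rmult_le_pos; [|apply sqrt_pos].
    generalize (Rabs_pos (N - p)). lra. }
  assert (Hr2 : r * r = B * B + A * (p - 1) * (N - p) ^ 2).
  { unfold r.
    replace (2 * Rabs (N - p) * sqrt (q * (p + q - 1)) *
             (2 * Rabs (N - p) * sqrt (q * (p + q - 1))))
      with (4 * (Rabs (N - p)) ^ 2 * (sqrt (q * (p + q - 1)) * sqrt (q * (p + q - 1))))
      by ring.
    rewrite sqrt_sqrt by (apply Rmult_le_pos; lra).
    rewrite pow2_abs. unfold A, B. ring. }
  assert (H1 : r < A * b + B).
  { apply (Rmult_lt_compat_l A) in Hb; [|exact HA].
    replace (A * (((p - N) * (2 * q - p ^ 2 + 3 * p - 2) + r) / A))
      with (- B + r) in Hb by (unfold B; field; lra).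
    lra. }
  assert (H2 : 0 < A * (A * b ^ 2 + 2 * B * b - (p - 1) * (N - p) ^ 2)) by nra.
  assert (H3 : 0 < A * b ^ 2 + 2 * B * b - (p - 1) * (N - p) ^ 2).
  { apply Rmult_lt_reg_l with A; [exact HA|]. lra. }
  apply Rminus_lt_0.
  replace (_ - _) with ((A * b ^ 2 + 2 * B * b - (p - 1) * (N - p) ^ 2) / (p - 1)).
  - apply Rdiv_lt_0_compat; lra.
  - unfold A, B. field. lra.
Qed.

Lemma list_upper_bound (l : list R) : exists M, forall x, In x l -> x <= M.
Proof.
  induction l as [|y l [M HM]].
  - exists 0. intros x [].
  - exists (Rmax y M). intros x [<-|Hx]; [apply Rmax_l|].
    apply Rle_trans with M; [now apply HM|apply Rmax_r].
Qed.

(** * Limits along the solution curve *)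

Lemma is_lim_comp_ln (f : R -> R) (l : Rbar) :
  is_lim f p_infty l -> is_lim (fun t => f (ln t)) p_infty l.
Proof.
  intros Hf. apply (is_lim_comp f ln p_infty l p_infty Hf is_lim_ln_p).
  exists 0. intros t _. discriminate.
Qed.

Lemma lambda0_closed_form (n : nat) (p q alpha : R) :
  1 < p -> 0 < q ->
  0 < (p - 1) * (beta p q alpha - 1) + INR n - 1 ->
  lambda0 n p q alpha =
    Rpower (beta p q alpha) (p - 1)
    * ((p - 1) * (beta p q alpha - 1) + INR n - 1).
Proof.
  intros Hp Hq Hc. unfold lambda0, c0.
  set (c := (p - 1) * (beta p q alpha - 1) + INR n - 1) in *.
  assert (P : 0 < Rpower (beta p q alpha) (p - 1)) by apply exp_pos.
  rewrite Rpower_mult.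
  replace (1 / (p + q - 1) * (p + q - 1)) with 1 by (field; lra).
  rewrite Rpower_1; [field; lra|].
  apply Rdiv_lt_0_compat; [lra|]. now apply Rmult_lt_0_compat.
Qed.

Lemma is_lim_log_lambda (n : nat) (p q alpha : R) (w : R -> R) :
  (1 <= n)%nat -> 1 < p -> 0 < q -> 0 < alpha -> ivp_solution n p q alpha w ->
  0 < (p - 1) * (beta p q alpha - 1) + INR n - 1 ->
  is_lim (log_lambda p q alpha w) p_infty (ln (lambda0 n p q alpha)).
Proof.
  intros Hn Hp Hq Hal H Hc.
  rewrite lambda0_closed_form by assumption.
  assert (LV := ivp_lotka_volterra n p q alpha w Hn Hp Hq H).
  set (b := beta p q alpha) in *. set (c := (p - 1) * (b - 1) + INR n - 1) in *.
  assert (Hb : 0 < b) by (apply Rdiv_lt_0_compat; lra).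
  destruct (lotka_volterra_converges (p - 1) q b c _ _ ltac:(lra) Hq Hb Hc LV)
    as [LX LY].
  assert (Lln : forall f l, 0 < l -> is_lim f p_infty l ->
            is_lim (fun s => ln (f s)) p_infty (ln l)).
  { intros f l Hl Hf. apply (is_lim_comp_continuous f ln p_infty l Hf).
    apply continuity_pt_filterlim. apply derivable_continuous_pt.
    exists (/ l). now apply derivable_pt_lim_ln. }
  rewrite ln_mult; [|apply exp_pos|exact Hc].
  unfold Rpower. rewrite ln_exp.
  apply is_lim_ext with (fun s => (p - 1) * ln (growth_ratio p w s)
                                   + ln (forcing_ratio p q alpha w s)).
  { intros s. symmetry. now apply log_lambda_ratios. }
  apply is_lim_plus'; [|now apply Lln].
  apply (is_lim_scal_l (fun s => ln (growth_ratio p w s)) (p - 1) p_infty (ln b)).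
  now apply Lln.
Qed.

Lemma is_lim_exp_comp (f : R -> R) (l : R) :
  is_lim f p_infty l -> is_lim (fun t => exp (f t)) p_infty (exp l).
Proof.
  intros Hf. apply (is_lim_comp_continuous f exp p_infty l Hf).
  apply continuity_pt_filterlim. apply derivable_continuous_pt, derivable_pt_exp.
Qed.

Lemma is_lim_curve_lambda (n : nat) (p q alpha : R) (w : R -> R) :
  (1 <= n)%nat -> 1 < p -> 0 < q -> 0 < alpha -> ivp_solution n p q alpha w ->
  0 < (p - 1) * (beta p q alpha - 1) + INR n - 1 ->
  is_lim (curve_lambda p q alpha w) p_infty (lambda0 n p q alpha).
Proof.
  intros Hn Hp Hq Hal H Hc.
  assert (P : 0 < lambda0 n p q alpha).
  { rewrite lambda0_closed_form by assumption.
    apply Rmult_lt_0_compat; [apply exp_pos|exact Hc]. }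
  rewrite <- (exp_ln _ P).
  apply is_lim_ext_loc with (fun t => exp (log_lambda p q alpha w (ln t))).
  - exists 0. intros t Ht. symmetry. now apply curve_lambda_exp.
  - apply is_lim_exp_comp, is_lim_comp_ln. now apply is_lim_log_lambda.
Qed.

(** Recovers [w] from lambda, so that the asymptotics of [w] follow from the limit
    of lambda. *)
Lemma log_profile_lambda (p q alpha : R) (w : R -> R) (s : R) :
  1 < p -> 0 < q ->
  log_profile w s = beta p q alpha * s - log_lambda p q alpha w s / (p + q - 1).
Proof. intros Hp Hq. unfold log_lambda, beta. field. lra. Qed.

Lemma ivp_reciprocal_vanishes (n : nat) (p q alpha : R) (w : R -> R) :
  (1 <= n)%nat -> 1 < p -> 0 < q -> 0 < alpha -> ivp_solution n p q alpha w ->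
  0 < (p - 1) * (beta p q alpha - 1) + INR n - 1 ->
  is_lim (fun t => / w t) p_infty 0.
Proof.
  intros Hn Hp Hq Hal H Hc.
  assert (Hb : 0 < beta p q alpha) by (apply Rdiv_lt_0_compat; lra).
  assert (L := is_lim_log_lambda n p q alpha w Hn Hp Hq Hal H Hc).
  apply is_lim_ext_loc with (fun t => exp (- log_profile w (ln t))).
  { exists 0. intros t Ht. unfold log_profile.
    rewrite exp_ln by exact Ht. rewrite exp_Ropp, exp_ln; [reflexivity|].
    destruct H as [_ [_ H]]. now apply H. }
  apply (is_lim_comp_ln (fun s => exp (- log_profile w s))).
  apply (is_lim_comp exp (fun s => - log_profile w s) p_infty 0 m_infty).
  - apply is_lim_exp_m.
  - apply is_lim_ext with
      (fun s => log_lambda p q alpha w s * / (p + q - 1) - beta p q alpha * s).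
    { intros s. rewrite (log_profile_lambda p q alpha w s Hp Hq). field. lra. }
    apply (is_lim_minus _ _ _ (ln (lambda0 n p q alpha) * / (p + q - 1)) p_infty).
    + apply (is_lim_scal_r _ (/ (p + q - 1)) p_infty (ln (lambda0 n p q alpha))).
      exact L.
    + now apply is_lim_linear_p_infty.
    + reflexivity.
  - exists 0. intros s _. discriminate.
Qed.

(** The quotient [w (t * r) / w t] is [r ^ beta] times a power of
    [lambda t / lambda (t * r)], which tends to 1. *)
Lemma is_lim_curve_u (n : nat) (p q alpha : R) (w : R -> R) (r : R) :
  (1 <= n)%nat -> 1 < p -> 0 < q -> 0 < alpha -> ivp_solution n p q alpha w ->
  0 < (p - 1) * (beta p q alpha - 1) + INR n - 1 -> 0 < r ->
  is_lim (fun t => curve_u w t r) p_infty (1 - Rpower r (beta p q alpha)).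
Proof.
  intros Hn Hp Hq Hal H Hc Hr.
  assert (L := is_lim_log_lambda n p q alpha w Hn Hp Hq Hal H Hc).
  set (l := ln (lambda0 n p q alpha)) in *.
  assert (Ls : is_lim (fun s => log_lambda p q alpha w (s + ln r)) p_infty l).
  { apply (is_lim_comp (log_lambda p q alpha w) (fun s => s + ln r)
             p_infty l p_infty L).
    - apply (is_lim_plus (fun s => s) (fun _ => ln r) p_infty p_infty (ln r));
        [apply is_lim_id|apply is_lim_const|reflexivity].
    - exists 0. intros s _. discriminate. }
  apply (is_lim_minus' (fun _ => 1) (fun t => w (t * r) / w t));
    [apply is_lim_const|].
  apply is_lim_ext_loc with (fun t => exp (beta p q alpha * ln r -
     (log_lambda p q alpha w (ln t + ln r) - log_lambda p q alpha w (ln t))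
     * / (p + q - 1))).
  { exists 0. intros t Ht.
    destruct H as [_ [_ H]].
    destruct (H t Ht) as [W1 _].
    destruct (H (t * r) (Rmult_lt_0_compat _ _ Ht Hr)) as [W2 _].
    replace (_ - _) with (log_profile w (ln t + ln r) - log_profile w (ln t))
      by (rewrite !(log_profile_lambda p q alpha) by assumption; field; lra).
    unfold log_profile. rewrite exp_plus, !exp_ln by assumption.
    unfold Rminus. now rewrite exp_plus, exp_Ropp, !exp_ln by assumption. }
  replace (Rpower r (beta p q alpha))
    with (exp (beta p q alpha * ln r - (l - l) * / (p + q - 1)))
    by (unfold Rpower; f_equal; ring).
  apply is_lim_exp_comp.
  apply is_lim_minus'; [apply is_lim_const|].
  apply (is_lim_scal_r _ (/ (p + q - 1)) p_infty (l - l)).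
  apply is_lim_minus'; [|now apply is_lim_comp_ln].
  exact (is_lim_comp_ln _ _ Ls).
Qed.

(** * The limiting profile *)

Lemma is_derive_Rpower (a r : R) :
  0 < r -> is_derive (fun s => Rpower s a) r (a * Rpower r (a - 1)).
Proof. intros Hr. apply is_derive_Reals. now apply derivable_pt_lim_power. Qed.

(** Both terms of the operator are multiples of [r ^ ((b - 1) * (p - 1) - 1)], and
    this exponent equals [alpha - b * q] by the definition of beta. *)
Lemma power_profile_solves (n : nat) (p q alpha : R) (r : R) :
  1 < p -> 0 < q -> 0 < alpha -> 0 < r ->
  0 < (p - 1) * (beta p q alpha - 1) + INR n - 1 ->
  bvp_equation_at n p q alpha (lambda0 n p q alpha)
    (fun s => 1 - Rpower s (beta p q alpha)) r.
Proof.
  intros Hp Hq Hal Hr Hc.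
  rewrite lambda0_closed_form by assumption.
  assert (Eb : beta p q alpha * (p + q - 1) = alpha + p) by (unfold beta; field; lra).
  assert (Hb : 0 < beta p q alpha) by (apply Rdiv_lt_0_compat; lra).
  set (b := beta p q alpha) in *. clearbody b.
  set (u := fun s : R => 1 - Rpower s b).
  assert (Du : forall s, 0 < s ->
            is_derive u s (- (b * Rpower s (b - 1)))).
  { intros s Hs.
    replace (- (b * Rpower s (b - 1))) with (0 - b * Rpower s (b - 1)) by ring.
    apply (is_derive_minus (fun _ => 1) (fun s => Rpower s b)).
    - apply (is_derive_const 1).
    - now apply is_derive_Rpower. }
  assert (Phi : forall s, 0 < s -> phi p (Derive u s)
            = - Rpower b (p - 1) * Rpower s ((b - 1) * (p - 1))).
  { intros s Hs. rewrite (is_derive_unique u s _ (Du s Hs)), phi_opp.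
    assert (P : 0 < Rpower s (b - 1)) by apply exp_pos.
    rewrite phi_of_pos by now apply Rmult_lt_0_compat.
    rewrite <- Rpower_mult_distr by assumption.
    rewrite Rpower_mult. ring. }
  set (e := (b - 1) * (p - 1)) in *.
  assert (DPhi : is_derive (fun s => phi p (Derive u s)) r
            (- Rpower b (p - 1) * (e * Rpower r (e - 1)))).
  { apply (is_derive_ext_loc (fun s => - Rpower b (p - 1) * Rpower s e)).
    - apply (locally_interval _ r 0 p_infty); [exact Hr|exact I|].
      intros s Hs _. symmetry. now apply Phi.
    - apply (is_derive_scal (fun s => Rpower s e)). now apply is_derive_Rpower. }
  split.
  - split; eexists; [now apply Du|exact DPhi].
  - unfold radial_plaplacian.
    apply is_derive_unique in DPhi.
    change (Derive (fun s : R => phi p (Derive u s)) r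
            = - Rpower b (p - 1) * (e * Rpower r (e - 1))) in DPhi.
    rewrite DPhi, (Phi r Hr).
    unfold u.
    replace (1 - (1 - Rpower r b)) with (Rpower r b) by ring.
    rewrite Rpower_mult.
    assert (E1 : Rpower r alpha / Rpower r (b * q) = Rpower r (e - 1)).
    { unfold Rdiv. rewrite <- Rpower_Ropp, <- Rpower_plus. f_equal. unfold e. lra. }
    assert (E2 : Rpower r e = r * Rpower r (e - 1)).
    { rewrite <- (Rpower_1 r Hr) at 2. rewrite <- Rpower_plus. f_equal. ring. }
    rewrite E1, E2. unfold e. field. lra.
Qed.

Theorem theorem3p1 (n : nat) (p q alpha : R) (w : R -> R)
  (hn : (1 <= n)%nat) (hp : 1 < p) (hq : 0 < q) (halpha : 0 < alpha)
  (hbeta : (p - 1) * (beta p q alpha - 1) + INR n - 1 > beta p q alpha)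
  (hpq : 4 * q - (p - 2) ^ 2 > 0)
  (hosc : (alpha + p) / (p + q - 1) >
     ((p - INR n) * (2 * q - p ^ 2 + 3 * p - 2)
        + 2 * Rabs (INR n - p) * sqrt (q * (p + q - 1)))
     / ((p - 1) * (4 * q - (p - 2) ^ 2)))
  (hw : ivp_solution n p q alpha w) :
  infinitely_many_turns (solution_curve p q alpha w) /\
  is_lim (fun t => snd (solution_curve p q alpha w t)) p_infty 1 /\
  is_lim (fun t => fst (solution_curve p q alpha w t)) p_infty
    (lambda0 n p q alpha) /\
  lambda0 n p q alpha =
    Rpower (beta p q alpha) (p - 1)
    * ((p - 1) * (beta p q alpha - 1) + INR n - 1) /\
  (forall r, 0 < r <= 1 ->
     is_lim (fun t => curve_u w t r) p_infty (1 - Rpower r (beta p q alpha))) /\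
  (forall r, 0 < r < 1 ->
     bvp_equation_at n p q alpha (lambda0 n p q alpha)
       (fun s => 1 - Rpower s (beta p q alpha)) r).
Proof.
  assert (Hb : 0 < beta p q alpha) by (apply Rdiv_lt_0_compat; lra).
  assert (Hc : 0 < (p - 1) * (beta p q alpha - 1) + INR n - 1) by lra.
  split; [|split; [|split; [|split; [|split]]]].
  - intros l. destruct (list_upper_bound l) as [M HM].
    assert (LV := ivp_lotka_volterra n p q alpha w hn hp hq hw).
    assert (Hm : 0 < p - 1) by lra.
    destruct (lotka_volterra_oscillates _ _ _ _ _ _ M Hm hq Hb Hc LV)
      as [s [Hs Xs]].
    { now apply focus_condition. }
    exists (exp s). split; [apply exp_pos|]. split.
    + now apply (turn_at_zero_of_slope n).
    + intros Hin. apply HM in Hin. generalize (exp_ineq1_le s). lra.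
  - replace (Finite 1) with (Finite (1 - 0)) by (f_equal; ring).
    apply is_lim_ext with (fun t => 1 - / w t).
    { intros t. unfold solution_curve, curve_u; simpl.
      rewrite Rmult_0_r. destruct hw as [-> _]. unfold Rdiv. ring. }
    apply is_lim_minus'; [apply is_lim_const|]. now apply (ivp_reciprocal_vanishes n p q alpha).
  - now apply is_lim_curve_lambda.
  - now apply lambda0_closed_form.
  - intros r Hr. now apply (is_lim_curve_u n).
  - intros r Hr. now apply power_profile_solves.
Qed.
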